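(* Let $(\mathcal M_1',\mathcal W_1')$, $(\mathcal M_1,\mathcal W_1)$, $(\mathcal M_2',\mathcal W_2')$, $(\mathcal M_2,\mathcal W_2)$ be four categories with weak equivalences and let $t_1:\mathcal M_1'\to\mathcal M_1$, $v_1:\mathcal M_1'\to\mathcal M_2$, $t_2:\mathcal M_2'\to\mathcal M_2$, $v_2:\mathcal M_2'\to\mathcal M_1$ be functors such that: (1) $v_1,v_2$ are partially adjoint with respect to $t_1,t_2$, i.e. there is a bijection $\zeta:\operatorname{Hom}_{\mathcal M_2}(v_1A',t_2B')\cong\operatorname{Hom}_{\mathcal M_1}(t_1A',v_2B')$ natural in $A'\in\mathcal M_1'$ and $B'\in\mathcal M_2'$; (2) $t_1$ is a left approximation and $t_2$ is a right approximation; (3) $v_1$ and $v_2$ preserve weak equivalences. Then $\mathbf{ho}v_1,\mathbf{ho}v_2$ are naturally partially adjoint with respect to $\mathbf{ho}t_1,\mathbf{ho}t_2$. Equivalently, if $\mathbf s_i$ denotes a quasi-inverse of $\mathbf{ho}t_i$ and $\mathbf V_i=\mathbf{ho}(v_i)\,\mathbf s_i$ for $i=1,2$, then $\mathbf V_1:\mathbf{ho}\mathcal M_1\rightleftarrows\mathbf{ho}\mathcal M_2:\mathbf V_2$ is a naturally adjoint pair $\mathbf V_1\dashv\mathbf V_2$. If additionally (4) (resp. (4r), resp. (4l)) holds: for any objects $A'\in\mathcal M_1'$, $B'\in\mathcal M_2'$, a map $v_1A'\to t_2B'$ is a weak equivalence if and only if (resp. if, resp. only if) its partial adjoint $t_1A'\to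 v_2B'$ under $\zeta$ is a weak equivalence; then $\mathbf V_1$ and $\mathbf V_2$ are inverse equivalences of categories (resp. $\mathbf V_2$ is fully faithful, resp. $\mathbf V_1$ is fully faithful).
   Context: Categories with weak equivalences here are category pairs: a category $\mathcal M$ with a class $\mathcal W$ of maps (weak equivalences) stable under composition and containing all identity maps. $\mathbf{ho}\mathcal M=\mathcal M[\mathcal W^{-1}]$ is the localization; a functor preserving weak equivalences induces $\mathbf{ho}$ of it. A category pair functor $t:(\mathcal M',\mathcal W')\to(\mathcal M,\mathcal W)$ is a functor with $t(\mathcal W')\subset\mathcal W$. Functors $v_1:\mathcal A\to\mathcal B$, $v_2:\mathcal D\to\mathcal C$ are partially adjoint with respect to $t_1:\mathcal A\to\mathcal C$, $t_2:\mathcal D\to\mathcal B$ if there is given a bijection $\operatorname{Hom}_{\mathcal B}(v_1A,t_2D)\cong\operatorname{Hom}_{\mathcal C}(t_1A,v_2D)$ natural in $A\in\mathcal A$, $D\in\mathcal D$. A category pair functor $t$ is a left approximation if: LAP1: for any object $A\in\mathcal M$ there are an object $A'\in\mathcal M'$ and a weak equivalence $tA'\to A$. LAP2: for any objects $A',B'\in\mathcal M'$, $B\in\mathcal M$, any map $f:tA'\to B$ in $\mathcal M$ and any $p:tB'\to B$ in $\mathcal W$: (1) there exist maps $i':A'\to D'$ and $j':B'\to D'$ in $\mathcal M'$ with $j'\in\mathcal W'$, and a weak equivalence $\sigma:tD'\to B$ in $\mathcal W$, with $\sigma\circ ti'=f$ and $\sigma\circ tj'=p$; (2) for any other such $i'',j'',\sigma''$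 (with some object $D''$), one has $j'^{-1}i'=j''^{-1}i''$ in $\mathbf{ho}\mathcal M'$. It is a right approximation if the dual conditions hold: RAP1: for any $A\in\mathcal M$ there are $A'\in\mathcal M'$ and a weak equivalence $A\to tA'$. RAP2: for any $f:A\to tB'$ in $\mathcal M$ and $i:A\to tA'$ in $\mathcal W$: (1) there exist maps $q':S'\to A'$, $p':S'\to B'$ in $\mathcal M'$ with $q'\in\mathcal W'$ and a weak equivalence $\tau:A\to tS'$ with $tq'\circ\tau=i$, $tp'\circ\tau=f$; (2) for any other such $p'',q'',\tau''$, one has $p'q'^{-1}=p''q''^{-1}$ in $\mathbf{ho}\mathcal M'$. For a left or right approximation $t$ the functor $\mathbf{ho}t$ is an equivalence of categories, so quasi-inverses exist. *)

(* Defs.v *)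
From mathcomp Require Import all_boot generic_quotient boolp.

Set Implicit Arguments.
Unset Strict Implicit.
Unset Printing Implicit Defensive.

Declare Scope cat_scope.
Delimit Scope cat_scope with cat.
Local Open Scope cat_scope.
Local Open Scope quotient_scope.

Reserved Notation "g ∘ f" (at level 40, left associativity).

(* [comp g f] is g after f. *)
Record category := Category {
  obj :> Type;
  Hom : obj -> obj -> Type;
  idm : forall x, Hom x x;
  comp : forall x y z, Hom y z -> Hom x y -> Hom x z;
  comp1m : forall x y (f : Hom x y), comp (idm y) f = f;
  compm1 : forall x y (f : Hom x y), comp f (idm x) = f;
  compA : forall x y z t (h : Hom z t) (g : Hom y z) (f : Hom x y),
    comp h (comp g f) = comp (comp h g) f }.

Arguments Hom {c} x y : rename.
Arguments idm {c} x : rename.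
Arguments comp {c x y z} g f : rename.
Notation "g ∘ f" := (comp g f) : cat_scope.

Definition is_iso (C : category) (x y : C) (f : Hom x y) : Prop :=
  exists g : Hom y x, g ∘ f = idm x /\ f ∘ g = idm y.

Record functor (C D : category) := Functor {
  fobj :> C -> D;
  fmap : forall x y : C, Hom x y -> Hom (fobj x) (fobj y);
  fmap1 : forall x, fmap (idm x) = idm (fobj x);
  fmapM : forall x y z (g : Hom y z) (f : Hom x y),
    fmap (g ∘ f) = fmap g ∘ fmap f }.

Arguments fmap {C D} F {x y} f : rename.

Definition id_functor (C : category) : functor C C.
Proof. by exists id (fun x y f => f). Defined.

Definition comp_functor (C D E : category) (G : functor D E) (F : functor C D) :
  functor C E.
Proof.
exists (fun x => G (F x)) (fun x y f => fmap G (fmap F f)).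
- by move=> x; rewrite !fmap1.
- by move=> x y z g f; rewrite !fmapM.
Defined.

Record nat_iso (C D : category) (F G : functor C D) := NatIso {
  ni_fwd : forall x, Hom (F x) (G x);
  ni_bwd : forall x, Hom (G x) (F x);
  ni_fwdK : forall x, ni_bwd x ∘ ni_fwd x = idm (F x);
  ni_bwdK : forall x, ni_fwd x ∘ ni_bwd x = idm (G x);
  ni_nat : forall x y (f : Hom x y), fmap G f ∘ ni_fwd x = ni_fwd y ∘ fmap F f }.

Record quasi_inverse (C D : category) (F : functor C D) (G : functor D C) :=
  QuasiInverse {
    qi_FG : nat_iso (comp_functor F G) (id_functor D);
    qi_GF : nat_iso (comp_functor G F) (id_functor C) }.

Definition fully_faithful (C D : category) (F : functor C D) : Prop :=
  forall x y : C, bijective (@fmap C D F x y).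

Record partial_adjunction (A B C D : category)
    (v1 : functor A B) (v2 : functor D C)
    (t1 : functor A C) (t2 : functor D B) := PartialAdjunction {
  padj :> forall (a : A) (d : D), Hom (v1 a) (t2 d) -> Hom (t1 a) (v2 d);
  padj_bij : forall a d, bijective (padj (a := a) (d := d));
  padj_nat : forall (a a' : A) (d d' : D) (f : Hom a' a) (g : Hom d d')
      (h : Hom (v1 a) (t2 d)),
    padj (fmap t2 g ∘ h ∘ fmap v1 f) = fmap v2 g ∘ padj h ∘ fmap t1 f }.

Arguments padj {A B C D v1 v2 t1 t2} z {a d} h : rename.

(* A left adjoint is a partial adjoint with respect to the identities. *)
Definition adjunction (A B : category) (V1 : functor A B) (V2 : functor B A) :=
  partial_adjunction V1 V2 (id_functor A) (id_functor B).

(* No two-out-of-three or saturation property is required of [we]. *)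
Record wecat := WeCat {
  wcat :> category;
  we : forall x y : wcat, Hom x y -> Prop;
  we1 : forall x, we (idm x);
  weM : forall x y z (g : Hom y z) (f : Hom x y), we g -> we f -> we (g ∘ f) }.

Arguments we {w x y} f : rename.

Definition preserves_we (M N : wecat) (F : functor M N) : Prop :=
  forall (x y : M) (f : Hom x y), we f -> we (fmap F f).

(* M[W^-1]: its morphisms are the formal composites of maps of M and inverses
   of maps of W, modulo the congruence generated by the category axioms, the
   functoriality of M -> M[W^-1] and the inverse laws. *)
Section Localization.
Variable M : wecat.

Inductive loc_term : M -> M -> Type :=
| LMap x y (f : Hom x y) : loc_term x y
| LInv x y (w : Hom x y) (ww : we w) : loc_term y x
| LComp x y z (g : loc_term y z) (f : loc_term x y) : loc_term x z.

Inductive loc_rel : forall x y, loc_term x y -> loc_term x y -> Prop :=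
| LRefl x y (f : loc_term x y) : loc_rel f f
| LSym x y (f g : loc_term x y) : loc_rel f g -> loc_rel g f
| LTrans x y (f g h : loc_term x y) : loc_rel f g -> loc_rel g h -> loc_rel f h
| LCong x y z (g g' : loc_term y z) (f f' : loc_term x y) :
    loc_rel g g' -> loc_rel f f' -> loc_rel (LComp g f) (LComp g' f')
| LAssoc x y z t (h : loc_term z t) (g : loc_term y z) (f : loc_term x y) :
    loc_rel (LComp h (LComp g f)) (LComp (LComp h g) f)
| LUnitL x y (f : loc_term x y) : loc_rel (LComp (LMap (idm y)) f) f
| LUnitR x y (f : loc_term x y) : loc_rel (LComp f (LMap (idm x))) f
| LMapM x y z (g : Hom y z) (f : Hom x y) :
    loc_rel (LMap (g ∘ f)) (LComp (LMap g) (LMap f))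
| LInvL x y (w : Hom x y) (ww : we w) :
    loc_rel (LComp (LInv ww) (LMap w)) (LMap (idm x))
| LInvR x y (w : Hom x y) (ww : we w) :
    loc_rel (LComp (LMap w) (LInv ww)) (LMap (idm y)).

Definition loc_eq (x y : M) : rel {classic loc_term x y} :=
  fun f g => `[< loc_rel f g >].

Lemma loc_eq_refl x y : reflexive (@loc_eq x y).
Proof. by move=> f; apply/asboolP; exact: LRefl. Qed.

Lemma loc_eq_sym x y : symmetric (@loc_eq x y).
Proof. by move=> f g; apply/asboolP/asboolP; exact: LSym. Qed.

Lemma loc_eq_trans x y : transitive (@loc_eq x y).
Proof.
by move=> g f h /asboolP fg /asboolP gh; apply/asboolP; exact: LTrans fg gh.
Qed.

Canonical loc_equiv x y :=
  EquivRel (@loc_eq x y) (@loc_eq_refl x y) (@loc_eq_sym x y) (@loc_eq_trans x y).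

Definition loc_hom (x y : M) : Type := {eq_quot (loc_equiv x y)}.

Definition loc_class x y (f : loc_term x y) : loc_hom x y :=
  \pi_({eq_quot (loc_equiv x y)}) (f : {classic loc_term x y}).

Definition loc_repr x y (a : loc_hom x y) : loc_term x y :=
  repr (a : {eq_quot (loc_equiv x y)}).

Lemma loc_reprK x y (a : loc_hom x y) : loc_class (loc_repr a) = a.
Proof. exact: reprK. Qed.

Lemma loc_classP x y (f g : loc_term x y) :
  loc_class f = loc_class g <-> loc_rel f g.
Proof.
split; first by move/eqmodP/asboolP.
by move=> fg; apply/eqmodP/asboolP.
Qed.

Lemma loc_class_repr x y (f : loc_term x y) : loc_rel (loc_repr (loc_class f)) f.
Proof. by apply/loc_classP; exact: loc_reprK. Qed.

Definition loc_comp x y z (b : loc_hom y z) (a : loc_hom x y) : loc_hom x z :=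
  loc_class (LComp (loc_repr b) (loc_repr a)).

Lemma loc_compE x y z (g : loc_term y z) (f : loc_term x y) :
  loc_comp (loc_class g) (loc_class f) = loc_class (LComp g f).
Proof. by apply/loc_classP; apply: LCong; exact: loc_class_repr. Qed.

Definition ho_cat : category.
Proof.
exists M loc_hom (fun x => loc_class (LMap (idm x))) loc_comp.
- move=> x y a; rewrite -(loc_reprK a) loc_compE.
  by apply/loc_classP; exact: LUnitL.
- move=> x y a; rewrite -(loc_reprK a) loc_compE.
  by apply/loc_classP; exact: LUnitR.
- move=> x y z t c b a.
  rewrite -(loc_reprK a) -(loc_reprK b) -(loc_reprK c) !loc_compE.
  by apply/loc_classP; exact: LAssoc.
Defined.

Definition gamma : functor M ho_cat.
Proof.
exists (fun x : M => x : ho_cat) (fun x y f => loc_class (LMap f)).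
- by [].
- by move=> x y z g f; rewrite /= loc_compE; apply/loc_classP; exact: LMapM.
Defined.

Definition gamma_inv (x y : M) (w : Hom x y) (ww : we w) :
  @Hom ho_cat y x := loc_class (LInv ww).

Lemma gamma_invL (x y : M) (w : Hom x y) (ww : we w) :
  gamma_inv ww ∘ fmap gamma w = idm (x : ho_cat).
Proof. by rewrite /= loc_compE; apply/loc_classP; exact: LInvL. Qed.

Lemma gamma_invR (x y : M) (w : Hom x y) (ww : we w) :
  fmap gamma w ∘ gamma_inv ww = idm (y : ho_cat).
Proof. by rewrite /= loc_compE; apply/loc_classP; exact: LInvR. Qed.

Lemma gamma_iso (x y : M) (w : Hom x y) : we w -> is_iso (fmap gamma w).
Proof.
by move=> ww; exists (gamma_inv ww); split; [exact: gamma_invL|exact: gamma_invR].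
Qed.

Section Lift.
Variables (C : category) (F : functor M C).
Hypothesis F_inv : forall (x y : M) (w : Hom x y), we w -> is_iso (fmap F w).

Fixpoint loc_eval x y (f : loc_term x y) : Hom (F x) (F y) :=
  match f with
  | LMap _ _ f => fmap F f
  | LInv _ _ _ ww => projT1 (cid (F_inv ww))
  | LComp _ _ _ g f => loc_eval g ∘ loc_eval f
  end.

Lemma loc_eval_rel x y (f g : loc_term x y) :
  loc_rel f g -> loc_eval f = loc_eval g.
Proof.
elim=> //= {x y f g}.
- by move=> x y f g h _ -> _ ->.
- by move=> x y z g g' f f' _ -> _ ->.
- by move=> *; rewrite compA.
- by move=> *; rewrite fmap1 comp1m.
- by move=> *; rewrite fmap1 compm1.
- by move=> *; rewrite fmapM.
- by move=> x y w ww; rewrite fmap1; case: cid => g [].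
- by move=> x y w ww; rewrite fmap1; case: cid => g [].
Qed.

Definition loc_lift : functor ho_cat C.
Proof.
exists (fun x : ho_cat => F x) (fun x y a => loc_eval (loc_repr a)).
- by move=> x; rewrite (loc_eval_rel (loc_class_repr _)) /= fmap1.
- by move=> x y z b a; rewrite (loc_eval_rel (loc_class_repr _)).
Defined.

Lemma loc_lift_gamma (x y : M) (f : Hom x y) :
  fmap loc_lift (fmap gamma f) = fmap F f.
Proof. by rewrite /= (loc_eval_rel (loc_class_repr _)). Qed.

End Lift.
End Localization.

Arguments gamma M : clear implicits.

Lemma functor_eq (C D : category) (o : C -> D)
    (m m' : forall x y, Hom x y -> Hom (o x) (o y)) e1 eM e1' eM' :
  (forall x y f, m x y f = m' x y f) ->
  @Functor C D o m e1 eM = @Functor C D o m' e1' eM'.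
Proof.
move=> mm'; have E : m = m'.
  do 2![apply: functional_extensionality_dep => ?].
  exact/funext/mm'.
subst m'.
by congr Functor; exact: Prop_irrelevance.
Qed.

Theorem localization_universal (M : wecat) (C : category) (F : functor M C) :
  (forall (x y : M) (w : Hom x y), we w -> is_iso (fmap F w)) ->
  exists! G : functor (ho_cat M) C, comp_functor G (gamma M) = F.
Proof.
move=> F_inv; exists (loc_lift F_inv); split.
  case: F F_inv => o m e1 eM F_inv; apply: functor_eq => x y f.
  exact: loc_lift_gamma.
move=> G GF; subst F; case: G F_inv => o m e1 eM F_inv.
apply: functor_eq => x y a.
rewrite -[in RHS](loc_reprK a); elim: (loc_repr a) => {x y a} //=.
- move=> x y w ww; case: cid => /= g [gw wg].
  set c := m _ _ _.
  have cw : c ∘ m _ _ (fmap (gamma M) w) = idm (o x).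
    by rewrite /c -eM (gamma_invL ww) e1.
  have wc : m _ _ (fmap (gamma M) w) ∘ c = idm (o y).
    by rewrite /c -eM (gamma_invR ww) e1.
  by rewrite -[g]compm1 -wc compA gw comp1m.
- by move=> x y z g -> f ->; rewrite -loc_compE eM.
Qed.

Lemma preserves_we_inv (M N : wecat) (F : functor M N) : preserves_we F ->
  forall (x y : M) (w : Hom x y), we w ->
    is_iso (fmap (comp_functor (gamma N) F) w).
Proof. by move=> FW x y w ww; apply/gamma_iso/FW. Qed.

Definition ho (M N : wecat) (F : functor M N) (FW : preserves_we F) :
  functor (ho_cat M) (ho_cat N) := loc_lift (preserves_we_inv FW).

Lemma ho_gamma (M N : wecat) (F : functor M N) (FW : preserves_we F)
    (x y : M) (f : Hom x y) :
  fmap (ho FW) (fmap (gamma M) f) = fmap (gamma N) (fmap F f).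
Proof. exact: (loc_lift_gamma (preserves_we_inv FW)). Qed.

Record left_approximation (M' M : wecat) (t : functor M' M) : Prop :=
  LeftApproximation {
  lap_we : preserves_we t;
  lap1 : forall A : M, exists (A' : M') (s : Hom (t A') A), we s;
  lap2 : forall (A' B' : M') (B : M) (f : Hom (t A') B) (p : Hom (t B') B),
    we p ->
    exists (D' : M') (i' : Hom A' D') (j' : Hom B' D') (wj' : we j')
           (sigma : Hom (t D') B),
      [/\ we sigma, sigma ∘ fmap t i' = f, sigma ∘ fmap t j' = p &
        forall (D'' : M') (i'' : Hom A' D'') (j'' : Hom B' D'') (wj'' : we j'')
               (sigma'' : Hom (t D'') B),
          we sigma'' -> sigma'' ∘ fmap t i'' = f -> sigma'' ∘ fmap t j'' = p ->
          gamma_inv wj' ∘ fmap (gamma M') i' =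
          gamma_inv wj'' ∘ fmap (gamma M') i''] }.

Record right_approximation (M' M : wecat) (t : functor M' M) : Prop :=
  RightApproximation {
  rap_we : preserves_we t;
  rap1 : forall A : M, exists (A' : M') (s : Hom A (t A')), we s;
  rap2 : forall (A' B' : M') (A : M) (f : Hom A (t B')) (i : Hom A (t A')),
    we i ->
    exists (S' : M') (q' : Hom S' A') (p' : Hom S' B') (wq' : we q')
           (tau : Hom A (t S')),
      [/\ we tau, fmap t q' ∘ tau = i, fmap t p' ∘ tau = f &
        forall (S'' : M') (q'' : Hom S'' A') (p'' : Hom S'' B') (wq'' : we q'')
               (tau'' : Hom A (t S'')),
          we tau'' -> fmap t q'' ∘ tau'' = i -> fmap t p'' ∘ tau'' = f ->
          fmap (gamma M') p' ∘ gamma_inv wq' =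
          fmap (gamma M') p'' ∘ gamma_inv wq''] }.

(* Main.v *)
(**
A left approximation [t1] admits unique fractions: each pair [f : t1 A' -> B],
[p : t1 B' -> B] with [p] in [W] determines a map [A' -> B'] of [ho M1'] lying
over [p^-1 f].  Choosing a weak equivalence [p_B : t1 (s B) -> B] for every [B],
these fractions make [s] a quasi-inverse of [ho t1], so [ho t1] is fully faithful.
Hence a map [ho t1 A' -> ho v2 B'] is [p ∘ ho t1 h] with [p] in [W], and it is
sent to [zeta^-1 p ∘ ho v1 h]; dually a map [ho v1 A' -> ho t2 B'] is
[ho t2 h ∘ i] and is sent to [ho v2 h ∘ zeta i].  Both assignments are natural,
hence mutually inverse.  If [zeta^-1 p] is a weak equivalence for every weak
equivalence [p], then [ho v2 h] is obtained from [h] by the bijections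
[h |-> ho t2 h], composition with [zeta^-1 p], transposition and composition
with [p^-1]; so [ho v2] is fully faithful, and dually for [ho v1].
*)
From mathcomp Require Import all_boot boolp.
Require Import Defs.

Set Implicit Arguments.
Unset Strict Implicit.
Unset Printing Implicit Defensive.

Local Open Scope cat_scope.

(** * Bijections and isomorphisms in a category *)

Lemma inj_surj_bij (A B : Type) (f : A -> B) :
  injective f -> (forall b, exists a, f a = b) -> bijective f.
Proof.
move=> f_inj f_surj; exists (fun b => projT1 (cid (f_surj b))) => [a|b].
  by case: cid => a' /= /f_inj.
by case: cid.
Qed.

Lemma bij_inverse (A B : Type) (f : A -> B) :
  bijective f -> {g | cancel f g & cancel g f}.
Proof.
move=> fbij; have /cid [g [fK gK]] : exists g, cancel f g /\ cancel g f.
  by case: fbij => g; exists g.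
by exists g.
Qed.

Section Isomorphisms.
Variable C : category.

Lemma isoP (x y : C) (f : Hom x y) :
  is_iso f -> {g : Hom y x | g ∘ f = idm x & f ∘ g = idm y}.
Proof. by case/cid => g [gf fg]; exists g. Qed.

Lemma iso_cancel_r (x y z : C) (f : Hom x y) (g h : Hom y z) :
  is_iso f -> g ∘ f = h ∘ f -> g = h.
Proof.
by case/isoP=> f' _ ff' E; rewrite -[g]compm1 -ff' compA E -compA ff' compm1.
Qed.

Lemma iso_cancel_l (x y z : C) (f : Hom y z) (g h : Hom x y) :
  is_iso f -> f ∘ g = f ∘ h -> g = h.
Proof.
by case/isoP=> f' f'f _ E; rewrite -[g]comp1m -f'f -compA E compA f'f comp1m.
Qed.

Lemma comp_iso_r_bij (x y z : C) (f : Hom x y) :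
  is_iso f -> bijective (fun g : Hom y z => g ∘ f).
Proof.
case/isoP=> f' f'f ff'; exists (fun g => g ∘ f') => g.
  by rewrite -compA ff' compm1.
by rewrite -compA f'f compm1.
Qed.

Lemma comp_iso_l_bij (x y z : C) (f : Hom y z) :
  is_iso f -> bijective (fun g : Hom x y => f ∘ g).
Proof.
case/isoP=> f' f'f ff'; exists (fun g => f' ∘ g) => g.
  by rewrite compA f'f comp1m.
by rewrite compA ff' comp1m.
Qed.

(** Yoneda: the preimage of [idm x] is a left inverse of [f], and injectivity at [z = y] makes it a
    right inverse. *)
Lemma precomp_bij_iso (x y : C) (f : Hom x y) :
  (forall z, bijective (fun g : Hom y z => g ∘ f)) -> is_iso f.
Proof.
move=> fbij; have [g _ gK] := fbij x; exists (g (idm x)); split => //.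
by apply: (bij_inj (fbij y)); rewrite -compA gK compm1 comp1m.
Qed.

Lemma postcomp_bij_iso (x y : C) (f : Hom x y) :
  (forall z, bijective (fun g : Hom z x => f ∘ g)) -> is_iso f.
Proof.
move=> fbij; have [g _ gK] := fbij y; exists (g (idm y)); split => //.
by apply: (bij_inj (fbij x)); rewrite compA gK compm1 comp1m.
Qed.

End Isomorphisms.

Lemma fmap_iso (C D : category) (F : functor C D) (x y : C) (f : Hom x y) :
  is_iso f -> is_iso (fmap F f).
Proof. by case=> g [gf fg]; exists (fmap F g); rewrite -!fmapM gf fg !fmap1. Qed.

(** * Natural isomorphisms, quasi-inverses and full faithfulness *)

Section NaturalIsomorphisms.
Variables (C D : category) (F G : functor C D).

Lemma nat_iso_of_iso (e : forall x, Hom (F x) (G x)) :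
  (forall x, is_iso (e x)) ->
  (forall x y (f : Hom x y), fmap G f ∘ e x = e y ∘ fmap F f) ->
  nat_iso F G.
Proof.
by move=> e_iso e_nat; exists e (fun x => s2val (isoP (e_iso x))) => // x;
  case: isoP.
Qed.

Lemma ni_fwd_iso (e : nat_iso F G) x : is_iso (ni_fwd e x).
Proof. by exists (ni_bwd e x); rewrite ni_fwdK ni_bwdK. Qed.

Lemma ni_bwd_iso (e : nat_iso F G) x : is_iso (ni_bwd e x).
Proof. by exists (ni_fwd e x); rewrite ni_fwdK ni_bwdK. Qed.

Lemma ni_bwd_nat (e : nat_iso F G) x y (f : Hom x y) :
  fmap F f ∘ ni_bwd e x = ni_bwd e y ∘ fmap G f.
Proof.
apply: (iso_cancel_l (ni_fwd_iso e y)).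
by rewrite !compA -ni_nat -compA ni_bwdK compm1 ni_bwdK comp1m.
Qed.

End NaturalIsomorphisms.

Lemma nat_iso_sym (C D : category) (F G : functor C D) :
  nat_iso F G -> nat_iso G F.
Proof.
move=> e; apply: (nat_iso_of_iso (ni_bwd_iso e)) => x y f.
exact: ni_bwd_nat.
Qed.

Lemma quasi_inverse_sym (C D : category) (F : functor C D) (G : functor D C) :
  quasi_inverse F G -> quasi_inverse G F.
Proof. by case=> FG GF; exists. Qed.

Lemma quasi_inverse_faithful (C D : category) (F : functor C D)
    (G : functor D C) (x y : C) :
  quasi_inverse F G -> injective (@fmap C D F x y).
Proof.
move=> [_ e] f g E; apply: (iso_cancel_r (ni_fwd_iso e x)).
have En := ni_nat e; rewrite (En _ _ f) (En _ _ g).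
by congr (_ ∘ _); exact: (congr1 (fun h => fmap G h) E).
Qed.

Lemma quasi_inverse_ff (C D : category) (F : functor C D) (G : functor D C) :
  quasi_inverse F G -> fully_faithful F.
Proof.
move=> q x y; apply: inj_surj_bij; first exact: quasi_inverse_faithful q.
move=> h; set e := qi_GF q.
exists (ni_fwd e y ∘ fmap G h ∘ ni_bwd e x).
(* [G] is faithful as well, so the candidate may be compared with [h] after applying [G], where
   naturality of [e] computes it. *)
apply: (quasi_inverse_faithful (quasi_inverse_sym q)).
apply: (iso_cancel_l (ni_fwd_iso e y)).
have /= <- := ni_nat e (ni_fwd e y ∘ fmap G h ∘ ni_bwd e x).
by rewrite -!compA (ni_fwdK e x) compm1.
Qed.

Lemma comp_functor_ff (C D E : category) (G : functor D E) (F : functor C D) :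
  fully_faithful G -> fully_faithful F -> fully_faithful (comp_functor G F).
Proof. by move=> Gff Fff x y; exact: (bij_comp (Gff _ _) (Fff x y)). Qed.

(** * Partial adjunctions and adjoint equivalences *)

Lemma padj_natl (A B C D : category) (v1 : functor A B) (v2 : functor D C)
    (t1 : functor A C) (t2 : functor D B) (Z : partial_adjunction v1 v2 t1 t2)
    (a a' : A) (d : D) (f : Hom a' a) (h : Hom (v1 a) (t2 d)) :
  padj Z (h ∘ fmap v1 f) = padj Z h ∘ fmap t1 f.
Proof. by have := padj_nat Z f (idm d) h; rewrite !fmap1 !comp1m. Qed.

Lemma padj_natr (A B C D : category) (v1 : functor A B) (v2 : functor D C)
    (t1 : functor A C) (t2 : functor D B) (Z : partial_adjunction v1 v2 t1 t2)
    (a : A) (d d' : D) (g : Hom d d') (h : Hom (v1 a) (t2 d)) :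
  padj Z (fmap t2 g ∘ h) = fmap v2 g ∘ padj Z h.
Proof. by have := padj_nat Z (idm a) g h; rewrite !fmap1 !compm1. Qed.

Section Adjunctions.
Variables (A B : category) (V1 : functor A B) (V2 : functor B A).
Variable Theta : adjunction V1 V2.

Let Theta_natl (a a' : A) (b : B) (f : Hom a' a) (h : Hom (V1 a) b) :
  padj Theta (a := a') (d := b) (h ∘ fmap V1 f) =
  padj Theta (a := a) (d := b) h ∘ f.
Proof. exact: (padj_natl Theta f h). Qed.

Let Theta_natr (a : A) (b b' : B) (g : Hom b b') (h : Hom (V1 a) b) :
  padj Theta (a := a) (d := b') (g ∘ h) =
  fmap V2 g ∘ padj Theta (a := a) (d := b) h.
Proof. exact: (padj_natr Theta g h). Qed.

(** Composition with the unit is [V1] on Hom sets followed by [Theta], hence bijective; so the unit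
    is invertible, and dually the counit. *)
Lemma adjunction_quasi_inverse :
  fully_faithful V1 -> fully_faithful V2 -> inhabited (quasi_inverse V1 V2).
Proof.
move=> ff1 ff2.
pose eta a := padj Theta (a := a) (d := V1 a) (idm (V1 a)).
have eta_iso a : is_iso (eta a).
  apply: postcomp_bij_iso => z.
  apply: (eq_bij (bij_comp (padj_bij Theta z (V1 a)) (ff1 z a))) => f /=.
  by rewrite /eta -Theta_natl comp1m.
pose eps b : Hom (V1 (V2 b)) b :=
  s2val (bij_inverse (padj_bij Theta (V2 b) b)) (idm (V2 b)).
have epsE b : padj Theta (a := V2 b) (d := b) (eps b) = idm (V2 b).
  by rewrite /eps; case: bij_inverse => /= g _; exact.
have eps_iso b : is_iso (eps b).
  apply: precomp_bij_iso => z; have [g gK Kg] := padj_bij Theta (V2 b) z.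
  apply: (eq_bij (bij_comp (Bijective Kg gK) (ff2 b z))) => f /=.
  by apply: (can_inj gK); rewrite Kg Theta_natr epsE compm1.
split; split.
- apply: (nat_iso_of_iso (F := comp_functor V1 V2) (G := id_functor B)
    eps_iso) => b b' f /=.
  apply: (bij_inj (padj_bij Theta _ _)).
  by rewrite Theta_natr Theta_natl !epsE compm1 comp1m.
- apply: nat_iso_sym.
  apply: (nat_iso_of_iso (F := id_functor A) (G := comp_functor V2 V1)
    eta_iso) => a a' f /=.
  by rewrite /eta -Theta_natr -Theta_natl compm1 comp1m.
Qed.

End Adjunctions.

(** * Induction on the morphisms of a localization *)

(** Reduces a claim to maps of [M]. The inverse case speaks of any two-sided inverse, so it can be
    settled by cancelling an isomorphism. *)
Lemma ho_ind (M : wecat) (P : forall x y : ho_cat M, Hom x y -> Prop) :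
  (forall (x y : M) (f : Hom x y), P x y (fmap (gamma M) f)) ->
  (forall x y (f : Hom x y) (g : Hom y x),
     g ∘ f = idm x -> f ∘ g = idm y -> P x y f -> P y x g) ->
  (forall x y z (g : Hom y z) (f : Hom x y), P y z g -> P x y f ->
     P x z (g ∘ f)) ->
  forall x y (a : Hom x y), P x y a.
Proof.
move=> Pmap Pinv Pcomp x y a; rewrite -(loc_reprK a).
elim: (loc_repr a) => {x y a} [x y f|x y w ww|x y z g Pg f Pf].
- exact: Pmap.
- exact: (Pinv _ _ _ _ (gamma_invL ww) (gamma_invR ww) (Pmap _ _ w)).
- by rewrite -loc_compE; exact: (Pcomp _ _ _ _ _ Pg Pf).
Qed.

Lemma ho_natural (M : wecat) (C : category) (F G : functor (ho_cat M) C)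
    (e : forall x, Hom (F x) (G x)) :
  (forall (x y : M) (f : Hom x y),
     fmap G (fmap (gamma M) f) ∘ e x = e y ∘ fmap F (fmap (gamma M) f)) ->
  forall x y (a : Hom x y), fmap G a ∘ e x = e y ∘ fmap F a.
Proof.
move=> e_nat; apply: ho_ind => // [x y f g gf fg Ef|x y z g f Eg Ef].
  apply: (@iso_cancel_l _ _ _ _ (fmap G f)).
    by apply: fmap_iso; exists g.
  by rewrite !compA -fmapM fg fmap1 comp1m Ef -compA -fmapM fg fmap1 compm1.
by rewrite !fmapM -compA Ef !compA Eg.
Qed.

Lemma gamma_inv_unique (M : wecat) (x y : M) (w : Hom x y) (ww : we w)
    (g : @Hom (ho_cat M) y x) :
  g ∘ fmap (gamma M) w = idm (x : ho_cat M) -> g = gamma_inv ww.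
Proof.
move=> gw; apply: (iso_cancel_r (gamma_iso ww)).
by rewrite gw gamma_invL.
Qed.

(** * Calculus of fractions for a left approximation *)

Section LeftApproximation.
Variables (M' M : wecat) (t : functor M' M) (ht : left_approximation t).

(** The uniqueness clause of the approximation makes the fraction independent of [D'], [i], [j] and
    [s]; the sigma type allows naming it. *)
Lemma left_fraction_ex (A' B' : M') (B : M) (f : Hom (t A') B)
    (p : Hom (t B') B) (wp : we p) :
  {c : @Hom (ho_cat M') A' B' |
    (exists (D' : M') (i : Hom A' D') (j : Hom B' D') (wj : we j)
       (s : Hom (t D') B),
       [/\ we s, s ∘ fmap t i = f, s ∘ fmap t j = p &
           c = gamma_inv wj ∘ fmap (gamma M') i]) /\
    (forall (D' : M') (i : Hom A' D') (j : Hom B' D') (wj : we j)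
       (s : Hom (t D') B),
       we s -> s ∘ fmap t i = f -> s ∘ fmap t j = p ->
       c = gamma_inv wj ∘ fmap (gamma M') i)}.
Proof.
apply: cid; have [D' [i [j [wj [s [ws si sj u]]]]]] := lap2 ht f wp.
exists (gamma_inv wj ∘ fmap (gamma M') i); split; first by exists D', i, j, wj, s.
exact: u.
Qed.

(* The map of [ho M'] whose image under [ho t] is [p^-1 f]. *)
Definition left_fraction (A' B' : M') (B : M) (f : Hom (t A') B)
    (p : Hom (t B') B) (wp : we p) : @Hom (ho_cat M') A' B' :=
  projT1 (left_fraction_ex f wp).

Lemma left_fractionP (A' B' : M') (B : M) (f : Hom (t A') B)
    (p : Hom (t B') B) (wp : we p) :
  exists (D' : M') (i : Hom A' D') (j : Hom B' D') (wj : we j)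
    (s : Hom (t D') B),
    [/\ we s, s ∘ fmap t i = f, s ∘ fmap t j = p &
        left_fraction f wp = gamma_inv wj ∘ fmap (gamma M') i].
Proof. by rewrite /left_fraction; case: left_fraction_ex => c []. Qed.

Lemma left_fractionE (A' B' D' : M') (B : M) (f : Hom (t A') B)
    (p : Hom (t B') B) (wp : we p)
    (i : Hom A' D') (j : Hom B' D') (wj : we j) (s : Hom (t D') B) :
  we s -> s ∘ fmap t i = f -> s ∘ fmap t j = p ->
  left_fraction f wp = gamma_inv wj ∘ fmap (gamma M') i.
Proof.
by rewrite /left_fraction; case: left_fraction_ex => c /= [_ u]; exact: u.
Qed.

Lemma left_fraction_id (A' : M') (B : M) (p : Hom (t A') B) (wp : we p) :
  left_fraction p wp = idm (A' : ho_cat M').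
Proof.
have E : p ∘ fmap t (idm A') = p by rewrite fmap1 compm1.
by rewrite (left_fractionE _ (we1 A') wp E E) gamma_invL.
Qed.

Lemma left_fraction_map (A' A'' B' : M') (B : M) (f : Hom (t A') B)
    (p : Hom (t B') B) (wp : we p) (a : Hom A'' A') :
  left_fraction (f ∘ fmap t a) wp = left_fraction f wp ∘ fmap (gamma M') a.
Proof.
have [D' [i [j [wj [s [ws si sj ->]]]]]] := left_fractionP f wp.
rewrite -compA -fmapM; apply: (left_fractionE _ _ ws) => //.
by rewrite fmapM compA si.
Qed.

(** In symbols, [(q^-1 g p)(p^-1 f) = q^-1 g f]. With [f = s ∘ t i] and [p = s ∘ t j], both sides
    are computed from the fraction of [g ∘ s] by [q], and [j] cancels. *)
Lemma left_fractionM (A' B' C' : M') (B C : M) (f : Hom (t A') B)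
    (p : Hom (t B') B) (wp : we p) (g : Hom B C) (q : Hom (t C') C)
    (wq : we q) :
  left_fraction (g ∘ p) wq ∘ left_fraction f wp = left_fraction (g ∘ f) wq.
Proof.
have [D' [i [j [wj [s [ws si sj ->]]]]]] := left_fractionP f wp.
rewrite -{1}sj -si !compA !left_fraction_map -(compA _ _ (gamma_inv _)).
by rewrite gamma_invR compm1.
Qed.

Lemma left_fraction_same (A' B' C' : M') (B : M) (f : Hom (t A') B)
    (p : Hom (t B') B) (wp : we p) (q : Hom (t C') B) (wq : we q) :
  left_fraction p wq ∘ left_fraction f wp = left_fraction f wq.
Proof. by have := left_fractionM f wp (idm B) wq; rewrite !comp1m. Qed.

Lemma ho_left_fraction (A' B' : M') (B : M) (f : Hom (t A') B)
    (p : Hom (t B') B) (wp : we p) :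
  fmap (gamma M) p ∘ fmap (ho (lap_we ht)) (left_fraction f wp) =
  fmap (gamma M) f.
Proof.
have [D' [i [j [wj [s [ws <- sj ->]]]]]] := left_fractionP f wp.
rewrite -sj !(fmapM (gamma M)) -!(ho_gamma (lap_we ht)) -compA -fmapM.
by rewrite (compA _ (gamma_inv _)) gamma_invR comp1m.
Qed.

Definition lap_obj (B : M) : M' := projT1 (cid (lap1 ht B)).

Definition lap_map (B : M) : Hom (t (lap_obj B)) B :=
  projT1 (cid (projT2 (cid (lap1 ht B)))).

Lemma lap_map_we (B : M) : we (lap_map B).
Proof. exact: projT2 (cid (projT2 (cid (lap1 ht B)))). Qed.

Definition lap_functor : functor M (ho_cat M').
Proof.
exists (fun B => lap_obj B : ho_cat M')
  (fun B C g => left_fraction (g ∘ lap_map B) (lap_map_we C)).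
- by move=> B; rewrite comp1m left_fraction_id.
- by move=> B C D h g; rewrite left_fractionM compA.
Defined.

Lemma lap_functor_inv (B C : M) (w : Hom B C) :
  we w -> is_iso (fmap lap_functor w).
Proof.
(* [w ∘ lap_map B] is a weak equivalence, so it can be the denominator of the inverse fraction. *)
move=> ww; exists (left_fraction (lap_map C) (weM ww (lap_map_we B))).
rewrite -[fmap _ w]/(left_fraction (w ∘ lap_map B) (lap_map_we C)).
by rewrite !left_fraction_same !left_fraction_id.
Qed.

Definition lap_inverse : functor (ho_cat M) (ho_cat M') :=
  loc_lift lap_functor_inv.

Lemma lap_inverse_gamma (B C : M) (f : Hom B C) :
  fmap lap_inverse (fmap (gamma M) f) =
  left_fraction (f ∘ lap_map B) (lap_map_we C).
Proof. exact: (loc_lift_gamma lap_functor_inv). Qed.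

Lemma lap_quasi_inverse : quasi_inverse (ho (lap_we ht)) lap_inverse.
Proof.
split.
- pose e (B : ho_cat M) : Hom (comp_functor (ho (lap_we ht)) lap_inverse B)
    (id_functor (ho_cat M) B) := fmap (gamma M) (lap_map B).
  apply: (nat_iso_of_iso (e := e)) => [B|]; first exact/gamma_iso/lap_map_we.
  apply: ho_natural => B C f; rewrite /e -(fmapM (gamma M)).
  by rewrite -(ho_left_fraction _ (lap_map_we C)) -lap_inverse_gamma.
- pose e (A' : ho_cat M') : Hom (comp_functor lap_inverse (ho (lap_we ht)) A')
    (id_functor (ho_cat M') A') := left_fraction (lap_map (t A')) (we1 (t A')).
  apply: (nat_iso_of_iso (e := e)) => [A'|].
    exists (left_fraction (idm (t A')) (lap_map_we (t A'))).
    by rewrite !left_fraction_same !left_fraction_id.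
  apply: ho_natural => A' B' a; rewrite /e.
  have -> : fmap (comp_functor lap_inverse (ho (lap_we ht))) (fmap (gamma M') a)
      = left_fraction (fmap t a ∘ lap_map (t A')) (lap_map_we (t B')).
    rewrite -lap_inverse_gamma -(ho_gamma (lap_we ht)).
    reflexivity.
  (* The fraction of [fmap t a] by an identity is the image of [a] in [ho M']; splitting it off on
     the right gives the left side. *)
  rewrite left_fraction_same -(left_fractionM _ (we1 (t A'))) compm1.
  by rewrite -[fmap t a]comp1m left_fraction_map left_fraction_id comp1m.
Qed.

End LeftApproximation.

(** * Opposite categories and their localizations *)

(* Right approximations are reduced to left ones on the opposite categories.
   The isomorphism of [ho (op M)] with the opposite of [ho M] is the identity
   on objects, so it is recorded by the maps [from_op] and [to_op] on Hom sets. *)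
Definition op_cat (C : category) : category.
Proof.
exists C (fun x y => @Hom C y x) (fun x => idm x) (fun x y z g f => f ∘ g).
- by move=> x y f; rewrite compm1.
- by move=> x y f; rewrite comp1m.
- by move=> x y z u h g f; rewrite compA.
Defined.

Definition op_functor (C D : category) (F : functor C D) :
  functor (op_cat C) (op_cat D).
Proof.
exists (fun x : op_cat C => F x : op_cat D) (fun x y f => @fmap C D F y x f).
- by move=> x; exact: fmap1.
- by move=> x y z g f; exact: fmapM.
Defined.

Definition op_wecat (M : wecat) : wecat.
Proof.
exists (op_cat M) (fun x y f => @we M y x f).
- by move=> x; exact: we1.
- by move=> x y z g f wg wf; exact: weM.
Defined.

Lemma op_preserves_we (M N : wecat) (F : functor M N) :
  preserves_we F -> @preserves_we (op_wecat M) (op_wecat N) (op_functor F).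
Proof. by move=> FW x y f; exact: FW. Qed.

Section OppositeLocalization.
Variable M : wecat.
Let Mop := op_wecat M.

Lemma op_gamma_inv (x y : Mop) (w : Hom x y) :
  we w -> is_iso (fmap (op_functor (gamma M)) w).
Proof.
move=> ww; exists (@gamma_inv M y x w ww).
by split; [exact: gamma_invR|exact: gamma_invL].
Qed.

(** Written out so that its source is [M] itself rather than the double opposite. *)
Definition gamma_op : functor M (op_cat (ho_cat Mop)).
Proof.
exists (fun x : M => x : op_cat (ho_cat Mop))
  (fun x y f => @fmap _ _ (gamma Mop) y x f).
- by move=> x; exact: (fmap1 (gamma Mop)).
- by move=> x y z g f; exact: (fmapM (gamma Mop)).
Defined.

Lemma gamma_op_inv (x y : M) (w : Hom x y) : we w -> is_iso (fmap gamma_op w).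
Proof.
move=> ww; exists (@gamma_inv Mop y x w ww).
by split; [exact: gamma_invR|exact: gamma_invL].
Qed.

Definition from_op (x y : M) (a : @Hom (ho_cat Mop) x y) : @Hom (ho_cat M) y x :=
  fmap (@loc_lift Mop _ _ op_gamma_inv) a.

Definition to_op (x y : M) (a : @Hom (ho_cat M) x y) : @Hom (ho_cat Mop) y x :=
  fmap (loc_lift gamma_op_inv) a.

Lemma from_op_gamma (x y : M) (f : Hom y x) :
  from_op (@fmap _ _ (gamma Mop) x y f) = fmap (gamma M) f.
Proof. exact: (@loc_lift_gamma Mop _ _ op_gamma_inv). Qed.

Lemma to_op_gamma (x y : M) (f : Hom x y) :
  to_op (fmap (gamma M) f) = @fmap _ _ (gamma Mop) y x f.
Proof. exact: (loc_lift_gamma gamma_op_inv). Qed.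

Lemma from_op1 (x : M) : from_op (idm (x : ho_cat Mop)) = idm (x : ho_cat M).
Proof. exact: (fmap1 (@loc_lift Mop _ _ op_gamma_inv)). Qed.

Lemma to_op1 (x : M) : to_op (idm (x : ho_cat M)) = idm (x : ho_cat Mop).
Proof. exact: (fmap1 (loc_lift gamma_op_inv)). Qed.

Lemma from_opM (x y z : M) (b : @Hom (ho_cat Mop) y z)
    (a : @Hom (ho_cat Mop) x y) : from_op (b ∘ a) = from_op a ∘ from_op b.
Proof. exact: (fmapM (@loc_lift Mop _ _ op_gamma_inv)). Qed.

Lemma to_opM (x y z : M) (b : @Hom (ho_cat M) y z) (a : @Hom (ho_cat M) x y) :
  to_op (b ∘ a) = to_op a ∘ to_op b.
Proof. exact: (fmapM (loc_lift gamma_op_inv)). Qed.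

Lemma to_op_inv (x y : M) (w : Hom x y) (ww : we w) :
  to_op (gamma_inv ww) = @gamma_inv Mop y x w ww.
Proof.
apply: gamma_inv_unique.
by rewrite -to_op_gamma -to_opM gamma_invR to_op1.
Qed.

(** The round trip fixes the images of maps of [M]; being functorial, it then fixes inverses and
    composites. *)
Lemma to_opK (x y : M) : cancel (@to_op x y) (@from_op y x).
Proof.
move: x y; apply: ho_ind => [x y f|x y f g gf fg fK|x y z g f gK fK].
- by rewrite to_op_gamma from_op_gamma.
- apply: (@iso_cancel_r (ho_cat M) _ _ _ f); first by exists g.
  by rewrite -[in LHS]fK -from_opM -to_opM gf to_op1 from_op1.
- by rewrite to_opM from_opM gK fK.
Qed.

Lemma from_opK (x y : M) : cancel (@from_op x y) (@to_op y x).
Proof.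
move: x y; apply: (@ho_ind Mop) => [x y f|x y f g gf fg fK|x y z g f gK fK].
- by rewrite from_op_gamma to_op_gamma.
- apply: (@iso_cancel_r (ho_cat Mop) _ _ _ f); first by exists g.
  by rewrite -[in LHS]fK -to_opM -from_opM gf from_op1 to_op1.
- by rewrite from_opM to_opM gK fK.
Qed.

End OppositeLocalization.

Section OppositeFunctor.
Variables (M N : wecat) (F : functor M N) (FW : preserves_we F).

Lemma to_op_fmap (x y : ho_cat M) (a : Hom x y) :
  to_op (fmap (ho FW) a) = fmap (ho (op_preserves_we FW)) (to_op a).
Proof.
move: x y a; apply: ho_ind => [x y f|x y f g gf fg Ef|x y z g f Eg Ef].
- by rewrite ho_gamma !to_op_gamma (@ho_gamma (op_wecat M)).
- apply: (@iso_cancel_r (ho_cat (op_wecat N)) _ _ _ (to_op (fmap (ho FW) f))).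
    exists (to_op (fmap (ho FW) g)).
    by rewrite -!to_opM -!fmapM gf fg !fmap1 !to_op1.
  rewrite [in RHS]Ef.
  apply: etrans (esym (to_opM (fmap (ho FW) f) (fmap (ho FW) g))) _.
  apply: etrans _ (fmapM (ho (op_preserves_we FW)) (to_op g) (to_op f)).
  by rewrite -fmapM -to_opM fg !fmap1 !to_op1 fmap1.
- by rewrite fmapM !to_opM fmapM Eg Ef.
Qed.

Lemma from_op_fmap (x y : ho_cat M) (a : @Hom (ho_cat (op_wecat M)) x y) :
  from_op (fmap (ho (op_preserves_we FW)) a) = fmap (ho FW) (from_op a).
Proof. by rewrite -[RHS]to_opK to_op_fmap from_opK. Qed.

End OppositeFunctor.

Lemma op_left_approximation (M' M : wecat) (t : functor M' M) :
  right_approximation t ->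
  @left_approximation (op_wecat M') (op_wecat M) (op_functor t).
Proof.
case=> tW t1 t2; split; first exact: op_preserves_we.
  exact: t1.
move=> A' B' B f p wp.
have [S' [q [r [wq [s [ws sq sr u]]]]]] := t2 B' A' B f p wp.
exists S', r, q, wq, s; split=> // D'' i'' j'' wj'' s'' ws'' si sj.
(* [u] gives an equation in [ho M']; [to_op] turns it into the equation of reversed fractions in the
   opposite localization. *)
have /(congr1 (@to_op _ _ _)) := u D'' j'' i'' wj'' s'' ws'' sj si.
by rewrite !to_opM !to_op_gamma !to_op_inv.
Qed.

(** * Full faithfulness and factorization for approximations *)

(** Stated for any proof [tW], so that it also applies to [op_preserves_we tW] on the opposite
    categories; proof irrelevance reduces it to [lap_we ht]. *)
Lemma left_approximation_ff (M' M : wecat) (t : functor M' M)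
    (ht : left_approximation t) (tW : preserves_we t) : fully_faithful (ho tW).
Proof.
rewrite (Prop_irrelevance tW (lap_we ht)).
exact: quasi_inverse_ff (lap_quasi_inverse ht).
Qed.

(** On Hom sets, [ho t] is the localized opposite functor placed between [to_op] and [from_op], and
    the opposite functor is a left approximation. *)
Lemma right_approximation_ff (M' M : wecat) (t : functor M' M)
    (ht : right_approximation t) (tW : preserves_we t) : fully_faithful (ho tW).
Proof.
move=> x y.
have op_ff := left_approximation_ff (op_left_approximation ht)
  (op_preserves_we tW).
have to_bij : bijective (@to_op M' x y).
  by exists (@from_op M' y x); [exact: to_opK|exact: from_opK].
have from_bij : bijective (@from_op M (t y) (t x)).
  by exists (@to_op M (t x) (t y)); [exact: from_opK|exact: to_opK].
apply: (eq_bij (bij_comp from_bij (bij_comp (op_ff y x) to_bij))) => a /=.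
by rewrite from_op_fmap to_opK.
Qed.

(** [h] is the lift of [p^-1 ∘ k] along the fully faithful [ho t], with [p] the chosen [lap_map]. It
    is given as data because [left_extension] defines a map from it. *)
Lemma left_factor (M' M : wecat) (t : functor M' M)
    (ht : left_approximation t) (tW : preserves_we t)
    (A' : ho_cat M') (B : ho_cat M) (k : Hom (ho tW A') B) :
  {h : @Hom (ho_cat M') A' (lap_obj ht B) |
    fmap (gamma M) (lap_map ht B) ∘ fmap (ho tW) h = k}.
Proof.
apply: cid; have [q _ pq] := isoP (gamma_iso (lap_map_we ht B)).
have [F _ FK] := left_approximation_ff ht tW A' (lap_obj ht B).
by exists (F (q ∘ k)); rewrite FK compA pq comp1m.
Qed.

Lemma right_factor (M' M : wecat) (t : functor M' M)
    (ht : right_approximation t) (tW : preserves_we t)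
    (A : ho_cat M) (B' : ho_cat M') (k : Hom A (ho tW B')) :
  exists (C' : M') (i : Hom (A : M) (t C')) (h : @Hom (ho_cat M') C' B'),
    fmap (ho tW) h ∘ fmap (gamma M) i = k.
Proof.
have [C' [i wi]] := rap1 ht A; exists C', i.
have [q qi _] := isoP (gamma_iso wi).
have [F _ FK] := right_approximation_ff ht tW C' B'.
by exists (F (k ∘ q)); rewrite FK -compA qi compm1.
Qed.

(** * Extension of transformations of Hom sets to localizations *)

(* A transformation [eta] of Hom sets, natural in [a] and [d] but not necessarily
   bijective, extends to [ho]: every map [k : ho t1 a -> ho v2 d] is [p ∘ ho t1 h]
   for a weak equivalence [p : t1 c -> v2 d], and
   [W k = gamma (eta p) ∘ ho v1 h] does not depend on this factorization. *)
Section LeftExtension.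
Variables (M1' M1 M2' M2 : wecat).
Variables (t1 : functor M1' M1) (v1 : functor M1' M2).
Variables (t2 : functor M2' M2) (v2 : functor M2' M1).
Variable eta : forall a d, Hom (t1 a) (v2 d) -> Hom (v1 a) (t2 d).
Hypothesis eta_nat : forall a a' d d' (f : Hom a' a) (g : Hom d d')
  (h : Hom (t1 a) (v2 d)),
  eta (fmap v2 g ∘ h ∘ fmap t1 f) = fmap t2 g ∘ eta h ∘ fmap v1 f.
Hypothesis ht1 : left_approximation t1.
Variables (t1W : preserves_we t1) (v1W : preserves_we v1).
Variables (t2W : preserves_we t2) (v2W : preserves_we v2).

Let eta_natl a a' d (f : Hom a' a) (h : Hom (t1 a) (v2 d)) :
  eta (h ∘ fmap t1 f) = eta h ∘ fmap v1 f.
Proof. by have := eta_nat f (idm d) h; rewrite !fmap1 !comp1m. Qed.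

Let eta_natr a d d' (g : Hom d d') (h : Hom (t1 a) (v2 d)) :
  eta (fmap v2 g ∘ h) = fmap t2 g ∘ eta h.
Proof. by have := eta_nat (idm a) g h; rewrite !fmap1 !compm1. Qed.

(** With [f = s ∘ t1 i] and [p = s ∘ t1 j], naturality gives [eta f = eta s ∘ v1 i] and
    [eta p = eta s ∘ v1 j]; the common factor [eta s] links them. *)
Let eta_left_fraction (a b : M1') (d : M2') (f : Hom (t1 a) (v2 d))
    (p : Hom (t1 b) (v2 d)) (wp : we p) :
  fmap (gamma M2) (eta p) ∘ fmap (ho v1W) (left_fraction ht1 f wp) =
  fmap (gamma M2) (eta f).
Proof.
have [D' [i [j [wj [s [ws <- sj ->]]]]]] := left_fractionP ht1 f wp.
rewrite -sj !eta_natl !(fmapM (gamma M2)) -!(ho_gamma v1W) -compA -fmapM.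
by rewrite (compA _ (gamma_inv _)) gamma_invR comp1m.
Qed.

Lemma left_extension :
  exists W : forall (a : ho_cat M1') (d : ho_cat M2'),
      Hom (ho t1W a) (ho v2W d) -> Hom (ho v1W a) (ho t2W d),
    (forall a a' d d' (f : Hom a' a) (g : Hom d d')
        (h : Hom (ho t1W a) (ho v2W d)),
      W a' d' (fmap (ho v2W) g ∘ h ∘ fmap (ho t1W) f) =
      fmap (ho t2W) g ∘ W a d h ∘ fmap (ho v1W) f) /\
    (forall (a : M1') (d : M2') (f : Hom (t1 a) (v2 d)),
      W a d (fmap (gamma M1) f) = fmap (gamma M2) (eta f)).
Proof.
pose W (a : ho_cat M1') (d : ho_cat M2') (k : Hom (ho t1W a) (ho v2W d)) :
    Hom (ho v1W a) (ho t2W d) :=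
  fmap (gamma M2) (eta (lap_map ht1 (v2 d))) ∘ fmap (ho v1W) (sval (left_factor ht1 k)).
(* Any factorization through a map [f] of [M1] computes [W]: since [ho t1] is faithful, the chosen
   [h0] must be [h] followed by the fraction of [f] by [lap_map]. *)
have WE (a : ho_cat M1') (c : M1') (d : M2') (f : Hom (t1 c) (v2 d))
    (h : @Hom (ho_cat M1') a c) :
    W a d (fmap (gamma M1) f ∘ fmap (ho t1W) h) =
    fmap (gamma M2) (eta f) ∘ fmap (ho v1W) h.
  rewrite /W; move: (sval (left_factor _ _))
    (svalP (left_factor ht1 (fmap (gamma M1) f ∘ fmap (ho t1W) h))) => h0 E.
  rewrite -(eta_left_fraction f (lap_map_we ht1 (v2 d))) -compA -fmapM.
  congr (_ ∘ fmap _ _).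
  apply: (bij_inj (left_approximation_ff ht1 t1W _ _)).
  apply: (iso_cancel_l (gamma_iso (lap_map_we ht1 (v2 d)))).
  rewrite E fmapM compA (Prop_irrelevance t1W (lap_we ht1)).
  by rewrite ho_left_fraction.
have Wl a a' d (f : Hom a' a) (k : Hom (ho t1W a) (ho v2W d)) :
    W a' d (k ∘ fmap (ho t1W) f) = W a d k ∘ fmap (ho v1W) f.
  have [h <-] := left_factor ht1 k.
  by rewrite -compA -fmapM !WE fmapM compA.
have Wr d d' (g : Hom d d') : forall a (k : Hom (ho t1W a) (ho v2W d)),
    W a d' (fmap (ho v2W) g ∘ k) = fmap (ho t2W) g ∘ W a d k.
  (* Here [g] is a morphism of [ho M2'], so the claim is proved for maps of [M2'] and passed to
     inverses and composites. *)
  move: d d' g; apply: ho_ind => [d d' g|d d' f g gf fg Ef|x y z g f Eg Ef] a k.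
  - have [h <-] := left_factor ht1 k.
    by rewrite !ho_gamma compA -(fmapM (gamma M1)) !WE eta_natr (fmapM (gamma M2))
      compA.
  - apply: (@iso_cancel_l _ _ _ _ (fmap (ho t2W) f)).
      by apply: fmap_iso; exists g.
    by rewrite -Ef !compA -!fmapM fg !fmap1 !comp1m.
  - by rewrite !fmapM -!compA Eg Ef.
exists W; split=> [a a' d d' f g h|a d f]; first by rewrite Wl Wr.
have := WE a a d f (idm (a : ho_cat M1')).
by rewrite !fmap1 !compm1.
Qed.

End LeftExtension.

(** This is [left_extension] on the opposite categories, with the indices 1 and 2 exchanged and
    [zeta] in the role of [eta]. *)
Lemma right_extension (M1' M1 M2' M2 : wecat)
    (t1 : functor M1' M1) (v1 : functor M1' M2)
    (t2 : functor M2' M2) (v2 : functor M2' M1)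
    (zeta : forall a d, Hom (v1 a) (t2 d) -> Hom (t1 a) (v2 d))
    (zeta_nat : forall a a' d d' (f : Hom a' a) (g : Hom d d')
      (h : Hom (v1 a) (t2 d)),
      zeta a' d' (fmap t2 g ∘ h ∘ fmap v1 f) =
      fmap v2 g ∘ zeta a d h ∘ fmap t1 f)
    (ht2 : right_approximation t2)
    (t1W : preserves_we t1) (v1W : preserves_we v1)
    (t2W : preserves_we t2) (v2W : preserves_we v2) :
  exists Z : forall (a : ho_cat M1') (d : ho_cat M2'),
      Hom (ho v1W a) (ho t2W d) -> Hom (ho t1W a) (ho v2W d),
    (forall a a' d d' (f : Hom a' a) (g : Hom d d')
        (h : Hom (ho v1W a) (ho t2W d)),
      Z a' d' (fmap (ho t2W) g ∘ h ∘ fmap (ho v1W) f) =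
      fmap (ho v2W) g ∘ Z a d h ∘ fmap (ho t1W) f) /\
    (forall (a : M1') (d : M2') (f : Hom (v1 a) (t2 d)),
      Z a d (fmap (gamma M2) f) = fmap (gamma M1) (zeta a d f)).
Proof.
have [|W [W_nat W_gamma]] := @left_extension
  (op_wecat M2') (op_wecat M2) (op_wecat M1') (op_wecat M1)
  (op_functor t2) (op_functor v2) (op_functor t1) (op_functor v1)
  (fun d a => zeta a d) _ (op_left_approximation ht2)
  (op_preserves_we t2W) (op_preserves_we v2W)
  (op_preserves_we t1W) (op_preserves_we v1W).
  move=> d d' a a' g f h; rewrite /= !compA; exact: zeta_nat.
exists (fun a d g => from_op (W d a (to_op g))); split.
- move=> a a' d d' f g h.
  rewrite !to_opM !to_op_fmap compA.
  apply: etrans (congr1 (@from_op _ _ _)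
    (W_nat d d' a a' (to_op g) (to_op f) (to_op h))) _.
  by rewrite !from_opM !from_op_fmap !to_opK compA.
- move=> a d f.
  by rewrite to_op_gamma W_gamma from_op_gamma.
Qed.

Lemma ho_partial_adjunction (M1' M1 M2' M2 : wecat)
    (t1 : functor M1' M1) (v1 : functor M1' M2)
    (t2 : functor M2' M2) (v2 : functor M2' M1)
    (zeta : partial_adjunction v1 v2 t1 t2)
    (ht1 : left_approximation t1) (ht2 : right_approximation t2)
    (hv1 : preserves_we v1) (hv2 : preserves_we v2) :
  exists Z : partial_adjunction (ho hv1) (ho hv2)
      (ho (lap_we ht1)) (ho (rap_we ht2)),
    forall (a : M1') (d : M2') (f : Hom (v1 a) (t2 d)),
      padj Z (a := a) (d := d) (fmap (gamma M2) f) =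
      fmap (gamma M1) (padj zeta f).
Proof.
have [Z [Z_nat Zgamma]] := right_extension (padj_nat zeta) ht2
  (lap_we ht1) hv1 (rap_we ht2) hv2.
pose eta a d := s2val (bij_inverse (padj_bij zeta a d)).
have zetaK a d : cancel (padj zeta (a := a) (d := d)) (eta a d).
  by rewrite /eta; case: bij_inverse.
have etaK a d : cancel (eta a d) (padj zeta (a := a) (d := d)).
  by rewrite /eta; case: bij_inverse.
have [|W [W_nat Wgamma]] := @left_extension _ _ _ _ t1 v1 t2 v2 eta _ ht1
  (lap_we ht1) hv1 (rap_we ht2) hv2.
  move=> a a' d d' f g h; apply: (can_inj (zetaK _ _)).
  by rewrite padj_nat !etaK.
have Zl a a' d (f : Hom a' a) h :
    Z a' d (h ∘ fmap (ho hv1) f) = Z a d h ∘ fmap (ho (lap_we ht1)) f.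
  by have := Z_nat _ _ _ _ f (idm d) h; rewrite !fmap1 !comp1m.
have Wr a d d' (g : Hom d d') h :
    W a d' (fmap (ho hv2) g ∘ h) = fmap (ho (rap_we ht2)) g ∘ W a d h.
  by have := W_nat _ _ _ _ (idm a) g h; rewrite !fmap1 !compm1.
have Zr a d d' (g : Hom d d') h :
    Z a d' (fmap (ho (rap_we ht2)) g ∘ h) = fmap (ho hv2) g ∘ Z a d h.
  by have := Z_nat _ _ _ _ (idm a) g h; rewrite !fmap1 !compm1.
have Wl a a' d (f : Hom a' a) h :
    W a' d (h ∘ fmap (ho (lap_we ht1)) f) = W a d h ∘ fmap (ho hv1) f.
  by have := W_nat _ _ _ _ f (idm d) h; rewrite !fmap1 !comp1m.
(* Naturality and the factorizations reduce the two round trips to images of maps of [M2] and of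
   [M1], where [zeta] and [eta] are inverse. *)
have Z_bij a d : bijective (Z a d).
  exists (W a d) => [g|k].
    have [c [f [h <-]]] := right_factor ht2 g.
    by rewrite Zr Zgamma Wr Wgamma zetaK.
  have [h <-] := left_factor ht1 k.
  by rewrite Wl Wgamma Zl Zgamma etaK.
by exists (PartialAdjunction Z_bij Z_nat).
Qed.

(** * Adjunction between the derived functors *)

Section DerivedAdjunction.
Variables (A B C D : category) (v1 : functor A B) (v2 : functor D C).
Variables (t1 : functor A C) (t2 : functor D B).
Variable Z : partial_adjunction v1 v2 t1 t2.
Variables (s1 : functor C A) (s2 : functor B D).
Variables (q1 : quasi_inverse t1 s1) (q2 : quasi_inverse t2 s2).

(** Transposition is [Z] composed with the isomorphisms [b ≅ t2 (s2 b)] and [c ≅ t1 (s1 c)], each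
    step a bijection of Hom sets. *)
Lemma derived_adjunction :
  exists Theta : adjunction (comp_functor v1 s1) (comp_functor v2 s2),
    forall (c : C) (b : B) (g : Hom (v1 (s1 c)) b),
      padj Theta (a := c) (d := b) g =
      padj Z (ni_bwd (qi_FG q2) b ∘ g) ∘ ni_bwd (qi_FG q1) c.
Proof.
pose V1 := comp_functor v1 s1; pose V2 := comp_functor v2 s2.
pose Theta (c : C) (b : B) (g : Hom (V1 c) (id_functor B b)) :
    Hom (id_functor C c) (V2 b) :=
  padj Z (ni_bwd (qi_FG q2) b ∘ g) ∘ ni_bwd (qi_FG q1) c.
have Theta_bij c b : bijective (Theta c b).
  apply: (bij_comp (comp_iso_r_bij _ (ni_bwd_iso (qi_FG q1) c))).
  apply: (bij_comp (padj_bij Z _ _)).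
  exact: (comp_iso_l_bij _ (ni_bwd_iso (qi_FG q2) b)).
have Theta_nat c c' b b' (f : Hom c' c) (g : Hom b b') (h : Hom (V1 c) b) :
    Theta c' b' (g ∘ h ∘ fmap V1 f) = fmap V2 g ∘ Theta c b h ∘ f.
  have n1 := ni_bwd_nat (qi_FG q1) f; have n2 := ni_bwd_nat (qi_FG q2) g.
  rewrite /Theta !compA -n2 /= padj_natl -!compA padj_natr n1.
  by rewrite !compA.
by exists (PartialAdjunction Theta_bij Theta_nat).
Qed.

End DerivedAdjunction.

(** * Full faithfulness of [ho v1] and [ho v2] *)

Section FullyFaithful.
Variables (M1' M1 M2' M2 : wecat).
Variables (t1 : functor M1' M1) (v1 : functor M1' M2).
Variables (t2 : functor M2' M2) (v2 : functor M2' M1).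
Variable zeta : partial_adjunction v1 v2 t1 t2.
Variables (ht1 : left_approximation t1) (ht2 : right_approximation t2).
Variables (t1W : preserves_we t1) (v1W : preserves_we v1).
Variables (t2W : preserves_we t2) (v2W : preserves_we v2).
Variable Z : partial_adjunction (ho v1W) (ho v2W) (ho t1W) (ho t2W).
Hypothesis Zgamma : forall (a : M1') (d : M2') (f : Hom (v1 a) (t2 d)),
  padj Z (a := a) (d := d) (fmap (gamma M2) f) = fmap (gamma M1) (padj zeta f).

(* If [zeta f] is a weak equivalence [p], then
   [ho v2 b = Z (ho t2 b ∘ f) ∘ p^-1] exhibits [ho v2] as a composite of
   bijections on each Hom set. *)
Lemma ho_right_partial_adjoint_ff :
  (forall (a : M1') (d : M2') (f : Hom (v1 a) (t2 d)),
     we (padj zeta f) -> we f) -> fully_faithful (ho v2W).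
Proof.
move=> zetaW b b'; have [a [p wp]] := lap1 ht1 (v2 b).
have [f Ef] : exists f : Hom (v1 a) (t2 b), padj zeta f = p.
  by case: (padj_bij zeta a b) => e _ eK; exists (e p).
have wf : we f by apply: zetaW; rewrite Ef.
have [q qp pq] := isoP (gamma_iso wp).
have q_iso : is_iso q by exists (fmap (gamma M1) p).
apply: (eq_bij (bij_comp (comp_iso_r_bij _ q_iso) (bij_comp (padj_bij Z a b')
  (bij_comp (comp_iso_r_bij _ (gamma_iso wf))
    (right_approximation_ff ht2 t2W b b'))))) => g.
rewrite -[LHS]/(padj Z (fmap (ho t2W) g ∘ fmap (gamma M2) f) ∘ q).
by rewrite padj_natr Zgamma Ef -compA pq compm1.
Qed.

(** For a weak equivalence [i : v1 a' -> t2 d], also [zeta i] is one, and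
    [ho v1 f = i^-1 ∘ Z^-1 (zeta i ∘ ho t1 f)] is a composite of bijections in [f]. *)
Lemma ho_left_partial_adjoint_ff :
  (forall (a : M1') (d : M2') (f : Hom (v1 a) (t2 d)),
     we f -> we (padj zeta f)) -> fully_faithful (ho v1W).
Proof.
move=> zetaW a a'; have [d [i wi]] := rap1 ht2 (v1 a').
have [q qi iq] := isoP (gamma_iso wi).
have q_iso : is_iso q by exists (fmap (gamma M2) i).
have [W ZK WK] := padj_bij Z a d.
apply: (eq_bij (bij_comp (comp_iso_l_bij _ q_iso) (bij_comp (Bijective WK ZK)
  (bij_comp (comp_iso_l_bij _ (gamma_iso (zetaW _ _ _ wi)))
    (left_approximation_ff ht1 t1W a a'))))) => f.
rewrite -[LHS]/(q ∘ W (fmap (gamma M1) (padj zeta i) ∘ fmap (ho t1W) f)).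
rewrite -Zgamma -(padj_natl Z f (fmap (gamma M2) i : Hom (ho v1W a') (ho t2W d))).
by rewrite ZK compA qi comp1m.
Qed.

End FullyFaithful.

(** * The derived adjunction and its criteria for full faithfulness and equivalence *)

Theorem theorem5p8p3 (M1' M1 M2' M2 : wecat)
  (t1 : functor M1' M1) (v1 : functor M1' M2)
  (t2 : functor M2' M2) (v2 : functor M2' M1)
  (zeta : partial_adjunction v1 v2 t1 t2)
  (ht1 : left_approximation t1) (ht2 : right_approximation t2)
  (hv1 : preserves_we v1) (hv2 : preserves_we v2) :
  let ho_t1 := ho (lap_we ht1) in
  let ho_t2 := ho (rap_we ht2) in
  exists Z : partial_adjunction (ho hv1) (ho hv2) ho_t1 ho_t2,
    (forall (A' : M1') (B' : M2') (f : Hom (v1 A') (t2 B')),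
       padj Z (a := A') (d := B') (fmap (gamma M2) f)
       = fmap (gamma M1) (padj zeta f)) /\
    (forall (s1 : functor (ho_cat M1) (ho_cat M1'))
            (s2 : functor (ho_cat M2) (ho_cat M2'))
            (q1 : quasi_inverse ho_t1 s1) (q2 : quasi_inverse ho_t2 s2),
       let V1 := comp_functor (ho hv1) s1 in
       let V2 := comp_functor (ho hv2) s2 in
       [/\ exists Theta : adjunction V1 V2,
             forall (A : ho_cat M1) (B : ho_cat M2) (g : Hom (V1 A) B),
               padj Theta (a := A) (d := B) g =
               padj Z (a := s1 A) (d := s2 B) (ni_bwd (qi_FG q2) B ∘ g)
               ∘ ni_bwd (qi_FG q1) A,
           (forall (A' : M1') (B' : M2') (f : Hom (v1 A') (t2 B')),
              we f <-> we (padj zeta f)) ->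
           inhabited (quasi_inverse V1 V2),
           (forall (A' : M1') (B' : M2') (f : Hom (v1 A') (t2 B')),
              we (padj zeta f) -> we f) ->
           fully_faithful V2 &
           (forall (A' : M1') (B' : M2') (f : Hom (v1 A') (t2 B')),
              we f -> we (padj zeta f)) ->
           fully_faithful V1]).
Proof.
move=> ho_t1 ho_t2.
have [Z Zgamma] := ho_partial_adjunction zeta ht1 ht2 hv1 hv2.
have ff1 := ho_left_partial_adjoint_ff ht1 ht2 Zgamma.
have ff2 := ho_right_partial_adjoint_ff ht1 ht2 Zgamma.
exists Z; split=> // s1 s2 q1 q2 V1 V2.
(* A quasi-inverse is fully faithful, so [V1] inherits full faithfulness from [ho hv1], and likewise
   [V2] from [ho hv2]. *)
have V1ff : fully_faithful (ho hv1) -> fully_faithful V1.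
  by move=> ff; apply: (comp_functor_ff ff);
    exact: quasi_inverse_ff (quasi_inverse_sym q1).
have V2ff : fully_faithful (ho hv2) -> fully_faithful V2.
  by move=> ff; apply: (comp_functor_ff ff);
    exact: quasi_inverse_ff (quasi_inverse_sym q2).
have [Theta ThetaE] := derived_adjunction Z q1 q2.
split; first by exists Theta.
- move=> zetaW; apply: (adjunction_quasi_inverse Theta).
    by apply/V1ff/ff1 => A' B' f /zetaW.
  by apply/V2ff/ff2 => A' B' f /zetaW.
- by move=> /ff2/V2ff.
- by move=> /ff1/V1ff.
Qed.
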